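(* Let $U_P(x)=-e^{-\gamma_P x}$ and $U_A(x)=-e^{-\gamma_A x}$ with $\gamma_P,\gamma_A>0$. (1) Let $(W^*,a^*,\lambda^*,Z^* )$ be the optimum, together with its Lagrange multipliers, of the one-sided problem $\sup_{(W,a)\in C_m}\mathbb{E}[U_P(X^a-W)]$, and set $$\tilde W=\frac{\gamma_P}{\gamma_P+\gamma_A}X^{a^*}+\frac{\gamma_A}{\gamma_P+\gamma_A}\kappa(a^* )+\frac{1}{\gamma_P+\gamma_A}\ln\left(\frac{\gamma_A\lambda^*}{\gamma_P}\right).$$ Then $\mathbb{P}$-a.s. $W^*=m\mathbf{1}_{\tilde W<m}+\tilde W\mathbf{1}_{\tilde W\ge m}$, and $$a^*=(\kappa')^{-1}\left(1+e^{\gamma_A y}\frac{\mathbb{E}[Z^*]}{\lambda^*\gamma_A}\right).$$ (2) Let $(W^*,a^*,\lambda^*,Z^*,Y^* )$ be the optimum, together with its Lagrange multipliers, of the double-sided problem $\sup_{(W,a)\in C_m^M}\mathbb{E}[U_P(X^a-W)]$, and set $\tilde W$ by the same formula as in (1) (with the present $a^*,\lambda^*$). Then $\mathbb{P}$-a.s. $W^*=m\mathbf{1}_{\tilde W<m}+\tilde W\mathbf{1}_{m\le\tilde W\le M}+M\mathbf{1}_{\tilde W>M}$, and $$a^*=(\kappa')^{-1}\left(1+e^{\gamma_A y}\frac{\mathbb{E}[Z^*-Y^*]}{\lambda^*\gamma_A}\right).$$ Moreover $\mathbb{E}[Z^*-Y^*]\ge\lambda^*\gamma_A e^{-\gamma_A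 y}(\kappa'(0)-1)\ge-\lambda^*\gamma_A e^{-\gamma_A y}$, thus ensuring that $a^*$ is non-negative. (3) In both cases the participation constraint is saturated at the optimum: $\mathbb{E}[U_A(W^*-\kappa(a^* ))]=U_A(y)$.
   Context: Let $\Omega$ be an uncountable sample space, $(\Omega,\mathbb{F},\mathbb{P})$ a probability space, $L^2(\Omega)$ the square-integrable real random variables, and $B\in L^2(\Omega)$. Fix $x_0\in\mathbb{R}$, $K>0$; set $X^a=x_0+a+B$ and $\kappa(a)=K a^2/2$ (so $\kappa'(a)=Ka$). $E=L^2(\Omega)\times\mathbb{R}$. Fix $0\le m\le y$, and $y\le M$ in the double-sided case; assume $\mathbb{E}[|U_P(X^0-y)|]<\infty$. Define $C_m=\{(W,a)\in E: m\le W\ \mathbb{P}\text{-a.s.},\ \mathbb{E}[U_A(W-\kappa(a))]\ge U_A(y)\}$, $C_m^M=\{(W,a)\in C_m: W\le M\ \mathbb{P}\text{-a.s.}\}$, $\mathcal{P}_W=\{Z\in L^2(\Omega): Z\ge0\ \mathbb{P}\text{-a.s.}\}$, $\tilde U_P=-U_P$, $\tilde U_A=-U_A$. ''Optimum together with its Lagrange multipliers'' means, in the double-sided case: $(W^*,a^* )\in C_m^M$ is a maximizer (optimal actions may be taken nonnegative), and $\lambda^*\in[0,\infty)$, $Z^*,Y^*\in\mathcal{P}_W$ satisfy (the expectations involved being finite): $\mathbb{E}[\tilde U_P'(X^{a^*}-W^* )]-\lambda^*\kappa'(a^* )\mathbb{E}[\tilde U_A'(W^*-\kappa(a^* ))]=0$;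 $-\tilde U_P'(X^{a^*}-W^* )+\lambda^*\tilde U_A'(W^*-\kappa(a^* ))-Z^*+Y^*=0$ $\mathbb{P}$-a.s.; $\lambda^*(\mathbb{E}[U_A(W^*-\kappa(a^* ))]-U_A(y))=0$; $\mathbb{E}[Z^*(W^*-m)]=0$ and $\mathbb{E}[Y^*(M-W^* )]=0$. In the one-sided case, $(W^*,a^* )\in C_m$ is a maximizer over $C_m$ and the same conditions hold with $Y^*$ set to $0$ (and no condition involving $M$). *)

(* Defs.v *)
From HB Require Import structures.
From mathcomp Require Import all_boot all_order all_algebra.
From mathcomp Require Import all_classical all_reals all_analysis.
Import Order.TTheory GRing.Theory Num.Theory.
Import numFieldNormedType.Exports.

Set Implicit Arguments.
Unset Strict Implicit.
Unset Printing Implicit Defensive.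

Local Open Scope classical_set_scope.
Local Open Scope ring_scope.

Section model.
Context {R : realType}.

Definition exp_utility (gamma x : R) : R := - expR (- (gamma * x)).

Definition quadratic_cost (K a : R) : R := K * a ^+ 2 / 2.

(* The inverse of f as a map of R: it is the two-sided inverse whenever f is
   bijective, as is the derivative of [quadratic_cost K] for K != 0. *)
Definition real_inv (f : R -> R) : R -> R := 'pinv_(fun=> 0) [set: R] f.

Definition outcome {T : Type} (x0 : R) (B : T -> R) (a : R) : T -> R :=
  fun w => x0 + a + B w.

End model.

Section contracting.
Context {d : measure_display} {T : measurableType d} {R : realType}.
Context (P : probability T R).

(* Random variables are represented by measurable functions rather than by
   classes modulo P-a.s. equality; every condition below is invariant under
   P-a.s. modification. *)
Definition L2 : set (T -> R) := [set f | f \in Lfun P 2%:E].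

Definition ae_nonneg_L2 : set (T -> R) :=
  [set Z | L2 Z /\ \forall w \ae P, 0 <= Z w].

Definition finite_expectation (f : T -> R) : Prop :=
  P.-integrable [set: T] (EFin \o f).

Context (U_P U_A kappa : R -> R) (X : R -> T -> R) (m y : R).

Definition agent_payoff (W : T -> R) (a : R) : T -> R :=
  fun w => U_A (W w - kappa a).

Definition principal_payoff (W : T -> R) (a : R) : T -> R :=
  fun w => U_P (X a w - W w).

(* The expectations are taken in the extended reals: [E[U_A(W - kappa(a))]]
   may be -oo, in which case the participation constraint fails. *)
Definition admissible : set ((T -> R) * R) :=
  [set Wa | [/\ L2 Wa.1,
                \forall w \ae P, m <= Wa.1 w &
                ((U_A y)%:E <= 'E_P[agent_payoff Wa.1 Wa.2])%E]].

Definition admissible_capped (M : R) : set ((T -> R) * R) :=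
  [set Wa | admissible Wa /\ \forall w \ae P, Wa.1 w <= M].

Definition maximizer (C : set ((T -> R) * R)) (W : T -> R) (a : R) : Prop :=
  C (W, a) /\
  forall (W' : T -> R) (a' : R), C (W', a') ->
    ('E_P[principal_payoff W' a'] <= 'E_P[principal_payoff W a])%E.

Definition dneg (U : R -> R) : R -> R := derive1 (fun x => - U x).

Definition dneg_principal (W : T -> R) (a : R) : T -> R :=
  fun w => dneg U_P (X a w - W w).

Definition dneg_agent (W : T -> R) (a : R) : T -> R :=
  fun w => dneg U_A (W w - kappa a).

Definition stationary (W : T -> R) (a lambda : R) (Z Y : T -> R) : Prop :=
  [/\ finite_expectation (dneg_principal W a),
      finite_expectation (dneg_agent W a),
      ('E_P[dneg_principal W a]
         - (lambda * derive1 kappa a)%:E * 'E_P[dneg_agent W a] = 0)%E &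
      \forall w \ae P,
        - dneg_principal W a w + lambda * dneg_agent W a w - Z w + Y w = 0].

Definition participation_slackness (W : T -> R) (a lambda : R) : Prop :=
  finite_expectation (agent_payoff W a) /\
  (lambda%:E * ('E_P[agent_payoff W a] - (U_A y)%:E) = 0)%E.

Definition slackness (Z gap : T -> R) : Prop :=
  finite_expectation (fun w => Z w * gap w) /\
  ('E_P[fun w => (Z w * gap w)%R] = 0)%E.

Definition one_sided_optimum (W : T -> R) (a lambda : R) (Z : T -> R) : Prop :=
  [/\ maximizer admissible W a,
      0 <= lambda /\ ae_nonneg_L2 Z,
      stationary W a lambda Z (fun=> 0),
      participation_slackness W a lambda &
      slackness Z (fun w => W w - m)].

Definition double_sided_optimum (M : R)
    (W : T -> R) (a lambda : R) (Z Y : T -> R) : Prop :=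
  [/\ maximizer (admissible_capped M) W a,
      [/\ 0 <= lambda, ae_nonneg_L2 Z & ae_nonneg_L2 Y],
      stationary W a lambda Z Y,
      participation_slackness W a lambda &
      slackness Z (fun w => W w - m) /\ slackness Y (fun w => M - W w)].

Definition participation_saturated (W : T -> R) (a : R) : Prop :=
  ('E_P[agent_payoff W a] = (U_A y)%:E)%E.

End contracting.

Definition unconstrained_wage {T : Type} {R : realType} (gammaP gammaA : R)
    (kappa : R -> R) (X : R -> T -> R) (a lambda : R) : T -> R :=
  fun w => gammaP / (gammaP + gammaA) * X a w
           + gammaA / (gammaP + gammaA) * kappa a
           + (gammaP + gammaA)^-1 * ln (gammaA * lambda / gammaP).

(* Main.v *)
Require Import Defs.
From HB Require Import structures.
From mathcomp Require Import all_boot all_order all_algebra.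
From mathcomp Require Import all_classical all_reals all_analysis.
From mathcomp Require Import ring lra.
Import Order.TTheory GRing.Theory Num.Theory.
Import numFieldNormedType.Exports.
Local Open Scope classical_set_scope.
Local Open Scope ring_scope.

(** Write U~ = - U; in the one-sided problem the multiplier Y of the cap is 0.
    For an exponential utility U~' is proportional to U, in particular negative
    everywhere.  Hence both expectations in the first-order condition in the
    action, E[U_P~'] = lambda K a E[U_A~'], are negative, so lambda K a > 0 and
    therefore lambda > 0 and a > 0 ([multiplier_action_gt0]).  Complementary
    slackness with lambda > 0 saturates the participation constraint
    ([participation_binds]).

    The action: saturation gives E[U_A~'] = - gamma_A exp(- gamma_A y).
    Integrating the pointwise first-order condition in the wage and
    substituting the one in the action yields
    E[Z - Y] = lambda gamma_A exp(- gamma_A y) (K a - 1)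
    ([mean_excess]), which is solved for a; with a > 0 it also gives the
    lower bound on E[Z - Y].

    The wage: the pointwise condition says that Z - Y is the difference of the
    two weighted marginal utilities at W.  Their ratio is
    exp((gamma_P + gamma_A) (W - Wt)), so Z - Y has the sign of W - Wt
    ([multiplier_sign]).  The slackness conditions hold pointwise almost
    surely, since nonnegative functions with zero integral vanish a.e.
    ([slackness_ae]); so W > Wt is possible only at the floor m and W < Wt only
    at the cap M, which is to say that W is the truncation of Wt
    ([clamped_wage]). *)

(** * Marginal utility and marginal cost *)

Section marginals.
Context {R : realType}.
Implicit Types g x K a : R.

Lemma dneg_exp_utility g x : dneg (exp_utility g) x = g * exp_utility g x.
Proof.
rewrite /dneg /exp_utility derive1E.
under eq_fun do rewrite opprK.
have dl : is_derive x (1 : R) (fun z : R => - (g * z)) (- g).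
  have := is_deriveN (is_deriveZ g (is_derive_id x (1 : R))).
  by rewrite /GRing.scale/= mulr1.
have e := @is_derive1_comp _ expR (fun z => - (g * z)) x _ _
  (is_derive_expR _) dl.
by rewrite (@derive_val _ _ _ _ _ _ _ e) !mulrN mulrC.
Qed.

Lemma dneg_exp_utility_lt0 g x : 0 < g -> dneg (exp_utility g) x < 0.
Proof.
by move=> g0; rewrite dneg_exp_utility pmulr_rlt0// oppr_lt0 expR_gt0.
Qed.

Lemma derive1_quadratic_cost K a : derive1 (quadratic_cost K) a = K * a.
Proof.
rewrite derive1E.
have e := is_deriveZ (K / 2) (is_deriveX 2 (is_derive_id a (1 : R))).
have -> : quadratic_cost K = (K / 2) \*: (id ^+ 2 : R -> R).
  by apply/funext => z; rewrite /quadratic_cost /= /GRing.scale /= mulrAC exprfctE.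
rewrite (@derive_val _ _ _ _ _ _ _ e) /GRing.scale /= expr1 mulr1.
by field.
Qed.

Lemma real_inv_marginal_cost K a b : K != 0 -> K * a = b ->
  real_inv (derive1 (quadratic_cost K)) b = a.
Proof.
move=> K0 <-; rewrite -derive1_quadratic_cost.
apply: (pinvKV (fun=> 0) (A := [set: R])); last by rewrite inE.
by move=> u v _ _; rewrite !derive1_quadratic_cost; exact: mulfI.
Qed.

End marginals.

(** For boolean predicates, membership in the comprehension computes, so that
    sums of indicators can be evaluated by case analysis. *)
Lemma indic_pred {T : Type} {R : pzRingType} (p : T -> bool) (w : T) :
  \1_[set u | p u] w = (p w)%:R :> R.
Proof.
rewrite indicE; suff -> : (w \in [set u | p u]) = p w by [].
by apply/idP/idP; rewrite inE.
Qed.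

(** * The pointwise wage *)

Section wage.
Context {R : realType}.
Implicit Types gP gA x k w wt lambda m M z v : R.

(** The target [wt] is the wage at which the two weighted marginal utilities
    agree; both are exponential in the wage, with rates [gP] and [- gA]. *)
Lemma marginal_ratio {gP gA} x k w {lambda} :
    0 < gP -> 0 < gA -> 0 < lambda ->
  let wt := gP / (gP + gA) * x + gA / (gP + gA) * k
            + (gP + gA)^-1 * ln (gA * lambda / gP) in
  gP * expR (- (gP * (x - w))) =
  lambda * gA * expR (- (gA * (w - k))) * expR ((gP + gA) * (w - wt)).
Proof.
move=> P0 A0 l0 wt.
have s0 : gP + gA != 0 by rewrite gt_eqF ?addr_gt0.
have q0 : 0 < gA * lambda / gP by rewrite divr_gt0 ?mulr_gt0.
have -> : (gP + gA) * (w - wt) =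
    gA * (w - k) + - (gP * (x - w)) + - ln (gA * lambda / gP).
  by rewrite /wt; field.
rewrite !expRD !expRN lnK ?posrE//.
have e0 : expR (gA * (w - k)) != 0 by rewrite gt_eqF ?expR_gt0.
have e1 : expR (gP * (x - w)) != 0 by rewrite gt_eqF ?expR_gt0.
by field; rewrite e0 e1 !gt_eqF.
Qed.

Lemma multiplier_sign {gP gA x k w lambda z v} :
    0 < gP -> 0 < gA -> 0 < lambda ->
  let wt := gP / (gP + gA) * x + gA / (gP + gA) * k
            + (gP + gA)^-1 * ln (gA * lambda / gP) in
  gP * expR (- (gP * (x - w))) - lambda * gA * expR (- (gA * (w - k)))
    = z - v ->
  (wt < w -> v < z) /\ (w < wt -> z < v).
Proof.
move=> P0 A0 l0 wt; rewrite (marginal_ratio x k w P0 A0 l0) -/wt.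
set c := lambda * gA * expR (- _) => zv.
have c0 : 0 < c by rewrite !mulr_gt0 ?expR_gt0.
have {}zv : z - v = c * (expR ((gP + gA) * (w - wt)) - 1).
  by rewrite -zv; ring.
split=> ww; rewrite -subr_gt0.
  by rewrite zv mulr_gt0// subr_gt0 expR_gt1 mulr_gt0 ?subr_gt0// addr_gt0.
rewrite -opprB zv -mulrN mulr_gt0// opprB subr_gt0 expR_lt1.
by rewrite pmulr_rlt0 ?subr_lt0// addr_gt0.
Qed.

(** Pointwise complementary slackness: above the target the multiplier z of
    the floor is positive, so the floor binds; below it the multiplier v of
    the cap is positive, so the cap binds. *)
Lemma clamped_wage {wt w m M z v} :
    (wt < w -> v < z) /\ (w < wt -> z < v) ->
    0 <= z -> 0 <= v -> m <= w -> w <= M ->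
    z * (w - m) = 0 -> v * (M - w) = 0 ->
  w = if wt < m then m else if wt <= M then wt else M.
Proof.
move=> [up dn] z0 v0 mw wM zm vM.
have wm : wt < w -> w = m.
  move=> /up /(le_lt_trans v0) z_gt0; move/eqP: zm.
  by rewrite mulf_eq0 gt_eqF//= subr_eq0 => /eqP.
have wtop : w < wt -> w = M.
  move=> /dn /(le_lt_trans z0) v_gt0; move/eqP: vM.
  by rewrite mulf_eq0 gt_eqF//= subr_eq0 => /eqP.
case: (ltgtP w wt).
- move=> /[dup] /wtop wE lt; rewrite ltNge (le_trans mw (ltW lt))/=.
  by rewrite leNgt -wE lt.
- by move=> gt; rewrite -(wm gt) gt.
- by move=> <-; rewrite ltNge mw wM.
Qed.

(** The clamped case with the artificial cap max(w, wt) and a zero multiplier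
    on it: the target never exceeds this cap. *)
Lemma floored_wage {wt w m z} :
    (wt < w -> 0 < z) /\ (w < wt -> z < 0) ->
    0 <= z -> m <= w -> z * (w - m) = 0 ->
  w = if wt < m then m else wt.
Proof.
move=> s z0 mw zm; pose M := Num.max w wt.
have wM : w <= M by rewrite le_max lexx.
have wtM : wt <= M by rewrite le_max lexx orbT.
by have := clamped_wage s z0 (lexx 0) mw wM zm (mul0r _); rewrite wtM.
Qed.

End wage.

(** * Expectations of random variables of constant sign *)

Section expectation.
Context {d : measure_display} {T : measurableType d} {R : realType}.
Context {P : probability T R}.
Implicit Types f Z : T -> R.

Lemma expectation_eq0_ae {f} :
    finite_expectation P f -> (\forall w \ae P, 0 <= f w) ->
  ('E_P[f] = 0)%E -> \forall w \ae P, f w = 0.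
Proof.
move=> If f0 Ef; have mf := measurable_int _ If.
have : (\int[P]_w `|(EFin \o f) w| = 0)%E.
  rewrite -Ef unlock; apply: ae_eq_integral => //.
    exact: (measurable_int _ (integrable_abse If)).
  by apply: filterS f0 => w f0 _ /=; rewrite ger0_norm.
move/(ae_eq_integral_abs P measurableT mf); apply: filterS => w /(_ I).
by case.
Qed.

Lemma expectation_gt0 {f} :
  finite_expectation P f -> (forall w, 0 < f w) -> (0 < 'E_P[f])%E.
Proof.
move=> If f0; rewrite lt_neqAle expectation_ge0 ?andbT; last first.
  by move=> w; exact: ltW.
apply/eqP => /esym /(expectation_eq0_ae If) fE.
have /fE f_ae0 : \forall w \ae P, 0 <= f w.
  by apply: nearW => w; exact: ltW.
have PT : (0 < P [set: T])%E by rewrite probability_setT.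
have PF := ae_properfilter_algebraOfSetsType PT.
by have [w fw] := filter_ex f_ae0; have := f0 w; rewrite fw ltxx.
Qed.

Lemma finite_expectationZ c {f} :
  finite_expectation P f -> finite_expectation P (fun w => c * f w).
Proof. by move=> If; exact: (integrableZl measurableT c If). Qed.

Lemma fin_expectationZ c {f} : finite_expectation P f ->
  ('E_P[fun w => (c * f w)%R] = c%:E * 'E_P[f])%E.
Proof. by move=> If; rewrite unlock -(integralZl measurableT If). Qed.

Lemma expectation_lt0 {f} :
  finite_expectation P f -> (forall w, f w < 0) -> ('E_P[f] < 0)%E.
Proof.
move=> If f0; rewrite -oppe_gt0 -mulN1e -EFinN -fin_expectationZ//.
apply: expectation_gt0; first exact: finite_expectationZ.
by move=> w; rewrite mulN1r oppr_gt0.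
Qed.

Lemma finite_expectation_fin_num {f} :
  finite_expectation P f -> ('E_P[f])%E \is a fin_num.
Proof. by move=> If; apply: expectation_fin_num; exact/Lfun1_integrable. Qed.

Lemma slackness_ae {Z gap} : slackness P Z gap ->
    (\forall w \ae P, 0 <= Z w) -> (\forall w \ae P, 0 <= gap w) ->
  \forall w \ae P, Z w * gap w = 0.
Proof.
move=> [If Ef] Z0 g0; apply: expectation_eq0_ae If _ Ef.
by apply: filterS2 Z0 g0 => w; exact: mulr_ge0.
Qed.

Lemma L2_finite_expectation {f} : L2 P f -> finite_expectation P f.
Proof.
move=> /= f2; apply/Lfun1_integrable; apply: Lfun_subset12 => //.
exact: fin_num_measure.
Qed.

End expectation.

(** * Consequences of the optimality conditions *)

Section optimum.
Context {d : measure_display} {T : measurableType d} {R : realType}.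
Context {P : probability T R} {X : R -> T -> R} {K y gP gA : R}.
Context (K_gt0 : 0 < K) (gP_gt0 : 0 < gP) (gA_gt0 : 0 < gA).
Local Notation U_P := (exp_utility gP).
Local Notation U_A := (exp_utility gA).
Local Notation kappa := (quadratic_cost K).
Implicit Types (W Z Y : T -> R) (a lambda : R).

(** In the condition E[U_P~'] = lambda K a E[U_A~'] both expectations are
    negative, which rules out lambda = 0 and a <= 0. *)
Lemma multiplier_action_gt0 {W a lambda Z Y} : 0 <= lambda ->
  stationary P U_P U_A kappa X W a lambda Z Y -> 0 < lambda /\ 0 < a.
Proof.
move=> l0 [Ip Iq foc _].
have p0 := expectation_lt0 Ip (fun=> dneg_exp_utility_lt0 _ _ gP_gt0).
have q0 := expectation_lt0 Iq (fun=> dneg_exp_utility_lt0 _ _ gA_gt0).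
move: foc p0 q0; rewrite derive1_quadratic_cost.
rewrite -(fineK (finite_expectation_fin_num Ip)).
rewrite -(fineK (finite_expectation_fin_num Iq)).
move: (fine _) (fine _) => p q; rewrite -EFinM -EFinB !lte_fin => -[].
move=> /eqP; rewrite subr_eq0 => /eqP -> + q0.
rewrite nmulr_llt0// => lKa.
have {}l0 : 0 < lambda.
  by rewrite lt_neqAle l0 andbT; apply: contraTN lKa => /eqP <-; rewrite mul0r ltxx.
by split=> //; move: lKa; rewrite !pmulr_rgt0.
Qed.

Lemma multiplier_sign_ae {W a lambda Z Y} : 0 < lambda ->
    stationary P U_P U_A kappa X W a lambda Z Y ->
    let Wt := unconstrained_wage gP gA kappa X a lambda in
  \forall w \ae P, (Wt w < W w -> Y w < Z w) /\ (W w < Wt w -> Z w < Y w).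
Proof.
move=> l0 [_ _ _]; apply: filterS => w.
rewrite /dneg_principal /dneg_agent !dneg_exp_utility /exp_utility => foc.
apply: (multiplier_sign (x := X a w) (k := kappa a) gP_gt0 gA_gt0 l0).
by move: foc; move: (expR _) (expR _) => u v; lra.
Qed.

Lemma participation_binds {W a lambda} : 0 < lambda ->
  participation_slackness P U_A kappa y W a lambda ->
  participation_saturated P U_A kappa y W a.
Proof.
move=> l0 [Iu]; rewrite /participation_saturated.
rewrite -(fineK (finite_expectation_fin_num Iu)) -EFinB -EFinM => -[] /eqP.
by rewrite mulf_eq0 gt_eqF//= subr_eq0 => /eqP ->.
Qed.

(** The expectation of Z - Y = lambda U_A~' - U_P~' is lambda (1 - K a) E[U_A~']
    by the first-order condition in the action, and E[U_A~'] is gA times the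
    expected payoff of the agent, which is known once participation binds. *)
Lemma mean_excess {W a lambda Z Y} :
    finite_expectation P Z -> finite_expectation P Y ->
    stationary P U_P U_A kappa X W a lambda Z Y ->
    finite_expectation P (agent_payoff U_A kappa W a) ->
    participation_saturated P U_A kappa y W a ->
  fine 'E_P[Z \- Y] = lambda * gA * expR (- (gA * y)) * (K * a - 1).
Proof.
move=> IZ IY [Ip Iq foc sta] Iu sat.
have qE : dneg_agent U_A kappa W a = fun w => gA * agent_payoff U_A kappa W a w.
  by apply/funext => w; rewrite /dneg_agent dneg_exp_utility.
have Eq : ('E_P[dneg_agent U_A kappa W a])%E = (- (gA * expR (- (gA * y))))%:E.
  by rewrite qE fin_expectationZ// sat -EFinM mulrN.
have IlQ := finite_expectationZ lambda Iq.
have -> : ('E_P[Z \- Y] = 'E_P[(fun w => lambda * dneg_agent U_A kappa W a w)%R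
     \- dneg_principal U_P X W a])%E.
  rewrite unlock; apply: ae_eq_integral => //.
  - exact: (measurable_int _ (integrableB measurableT IZ IY)).
  - exact: (measurable_int _ (integrableB measurableT IlQ Ip)).
  - apply: filterS sta => w h _ /=; congr EFin.
    by move: h; move: (dneg_principal _ _ _ _ _) (lambda * _) => u v; lra.
rewrite expectationB; [|exact/Lfun1_integrable..].
move: foc; rewrite fin_expectationZ// Eq derive1_quadratic_cost.
rewrite -(fineK (finite_expectation_fin_num Ip)) -!EFinM -!EFinB /= => -[].
by move: (fine _) => p; lra.
Qed.

Lemma action_of_mean_excess {a lambda D} : 0 < lambda ->
    D = lambda * gA * expR (- (gA * y)) * (K * a - 1) ->
  a = real_inv (derive1 kappa) (1 + expR (gA * y) * (D / (lambda * gA))).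
Proof.
move=> l0 ->; apply/esym/real_inv_marginal_cost; first by rewrite gt_eqF.
rewrite expRN; have e0 : expR (gA * y) != 0 by rewrite gt_eqF ?expR_gt0.
by field; rewrite e0 !gt_eqF.
Qed.

End optimum.

Theorem mainTheorem5 (R : realType) (d : measure_display)
    (T : measurableType d) (P : probability T R)
    (hT : ~ countable [set: T])
    (B : T -> R) (hB : L2 P B)
    (x0 K m y gammaP gammaA : R)
    (hK : 0 < K) (hm : 0 <= m) (hmy : m <= y)
    (hgP : 0 < gammaP) (hgA : 0 < gammaA) :
  let U_P := exp_utility gammaP in
  let U_A := exp_utility gammaA in
  let kappa := quadratic_cost K in
  let X := outcome x0 B in
  ('E_P[fun w => (`|U_P (X 0 w - y)|)%R] < +oo)%E ->
  [/\
   (forall (W : T -> R) (a lambda : R) (Z : T -> R),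
      one_sided_optimum P U_P U_A kappa X m y W a lambda Z ->
      let Wt := unconstrained_wage gammaP gammaA kappa X a lambda in
      [/\ 0 < lambda,
          \forall w \ae P,
            W w = m * \1_[set w | Wt w < m] w
                  + Wt w * \1_[set w | m <= Wt w] w &
          a = real_inv (derive1 kappa)
                (1 + expR (gammaA * y)
                     * (fine 'E_P[Z] / (lambda * gammaA)))]),
   (forall M : R, y <= M ->
    forall (W : T -> R) (a lambda : R) (Z Y : T -> R),
      double_sided_optimum P U_P U_A kappa X m y M W a lambda Z Y ->
      let Wt := unconstrained_wage gammaP gammaA kappa X a lambda in
      [/\ 0 < lambda,
          \forall w \ae P,
            W w = m * \1_[set w | Wt w < m] w
                  + Wt w * \1_[set w | m <= Wt w <= M] w
                  + M * \1_[set w | M < Wt w] w,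
          a = real_inv (derive1 kappa)
                (1 + expR (gammaA * y)
                     * (fine 'E_P[Z \- Y] / (lambda * gammaA))) &
          [/\ lambda * gammaA * expR (- (gammaA * y)) * (derive1 kappa 0 - 1)
                <= fine 'E_P[Z \- Y],
              - (lambda * gammaA * expR (- (gammaA * y)))
                <= lambda * gammaA * expR (- (gammaA * y)) * (derive1 kappa 0 - 1) &
              0 <= a]]) &
   (forall (W : T -> R) (a lambda : R) (Z : T -> R),
      one_sided_optimum P U_P U_A kappa X m y W a lambda Z ->
      participation_saturated P U_A kappa y W a)
   /\
   (forall M : R, y <= M ->
    forall (W : T -> R) (a lambda : R) (Z Y : T -> R),
      double_sided_optimum P U_P U_A kappa X m y M W a lambda Z Y ->
      participation_saturated P U_A kappa y W a)].
Proof.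
move=> U_P U_A kappa X _.
have int0 : finite_expectation P (fun=> 0).
  by apply/Lfun1_integrable; exact: Lfun_cst.
split.
- move=> W a lambda Z [[[_ W_ge _] _] [l_ge0 [LZ Z_ge0]] sta part sl] Wt.
  have [l_gt0 _] := multiplier_action_gt0 hK hgP hgA l_ge0 sta.
  have sat := participation_binds l_gt0 part.
  split=> //.
  + have gap_ge0 : \forall w \ae P, 0 <= W w - m.
      by apply: filterS W_ge => w; rewrite subr_ge0.
    have sgn := multiplier_sign_ae hgP hgA l_gt0 sta.
    have ZW0 := slackness_ae sl Z_ge0 gap_ge0.
    apply: filterS2 (filterI sgn ZW0) (filterI Z_ge0 W_ge) => w [s zw] [z0 mw].
    rewrite !indic_pred [LHS](floored_wage s z0 mw zw) -/Wt.
    by case: ltP => _; rewrite ?mulr1 ?mulr0 ?addr0 ?add0r.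
  + apply: (action_of_mean_excess (y := y) hK hgA l_gt0).
    have := mean_excess (L2_finite_expectation LZ) int0 sta part.1 sat.
    by congr (fine _ = _); congr expectation; apply/funext => w /=; rewrite subr0.
- move=> M _ W a lambda Z Y.
  move=> [[[[_ W_ge _] W_le] _] [l_ge0 [LZ Z_ge0] [LY Y_ge0]] sta part [slZ slY]].
  move=> Wt; have [l_gt0 a_gt0] := multiplier_action_gt0 hK hgP hgA l_ge0 sta.
  have sat := participation_binds l_gt0 part.
  have EZY := mean_excess (L2_finite_expectation LZ) (L2_finite_expectation LY)
    sta part.1 sat.
  split=> //.
  + have gapm_ge0 : \forall w \ae P, 0 <= W w - m.
      by apply: filterS W_ge => w; rewrite subr_ge0.
    have gapM_ge0 : \forall w \ae P, 0 <= M - W w.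
      by apply: filterS W_le => w; rewrite subr_ge0.
    have sgn := multiplier_sign_ae hgP hgA l_gt0 sta.
    have ZW0 := slackness_ae slZ Z_ge0 gapm_ge0.
    have YW0 := slackness_ae slY Y_ge0 gapM_ge0.
    apply: filterS3 (filterI sgn ZW0) (filterI Z_ge0 W_ge)
      (filterI (filterI Y_ge0 W_le) YW0) => w [s zw] [z0 mw] [[v0 wM] vw].
    rewrite !indic_pred [LHS](clamped_wage s z0 v0 mw wM zw vw) -/Wt.
    have mM := le_trans mw wM.
    case: (ltP (Wt w) m) => [lt|_] /=.
      rewrite ltNge (le_trans (ltW lt) mM)/=.
      by rewrite mulr1 !mulr0 !addr0.
    by case: leP => _; rewrite ?mulr1 ?mulr0 ?addr0 ?add0r.
  + exact: (action_of_mean_excess (y := y) hK hgA l_gt0).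
  + rewrite EZY !derive1_quadratic_cost mulr0 sub0r mulrN1 lexx.
    have c_ge0 : 0 <= lambda * gammaA * expR (- (gammaA * y)).
      by rewrite !mulr_ge0 ?expR_ge0 ?ltW.
    split=> //; last exact: ltW.
    by rewrite -mulrN1 ler_wpM2l// lerBrDr addNr mulr_ge0// ltW.
- split.
    move=> W a lambda Z [_ [l_ge0 _] sta part _].
    have [l_gt0 _] := multiplier_action_gt0 hK hgP hgA l_ge0 sta.
    exact: participation_binds l_gt0 part.
  move=> M _ W a lambda Z Y [_ [l_ge0 _ _] sta part _].
  have [l_gt0 _] := multiplier_action_gt0 hK hgP hgA l_ge0 sta.
  exact: participation_binds l_gt0 part.
Qed.
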